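(* Let $(X,r)$ be a finite square-free non-degenerate braided set. Then the number of $r$-orbits in $X^2$ is at least $2|X|-1$; that is, $\dim_K A_2\geq 2|X|-1$, where $A=A(K,X,r)$ for a field $K$.
   Context: A quadratic set $(X,r)$ is a nonempty set $X$ with a bijective map $r\colon X\times X\to X\times X$, written $r(x,y)=(\sigma_x(y),\gamma_y(x))$. It is non-degenerate if all $\sigma_x$ and $\gamma_x$ are bijective, and square-free if $r(x,x)=(x,x)$ for all $x\in X$. It is a braided set if $r_1r_2r_1=r_2r_1r_2$ on $X^3$, where $r_1=r\times \mathrm{id}_X$ and $r_2=\mathrm{id}_X\times r$. The $r$-orbits in $X^2$ are the orbits of the group $\langle r\rangle$ acting on $X^2$. The structure algebra is the $K$-algebra $A(K,X,r)=K\langle X\mid xy=uv \text{ whenever } r(x,y)=(u,v)\rangle$; it is graded by word length, $A=\bigoplus_{m\ge 0}A_m$, where $A_m$ is the $K$-span of all products $x_1\cdots x_m$ with $x_i\in X$. The dimension of $A_2$ equals the number of $r$-orbits in $X^2$. *)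

(* Defs.v *)
From HB Require Import structures.
From mathcomp Require Import all_boot all_fingroup all_algebra.
From mathcomp Require Import generic_quotient ring_quotient.
From mathcomp.classical Require Import boolp.
From mathcomp.finmap Require Import finmap.
From mathcomp.multinomials Require Import monalg.

Set Implicit Arguments.
Unset Strict Implicit.
Unset Printing Implicit Defensive.

Import GRing.Theory.
Local Open Scope ring_scope.
Local Open Scope quotient_scope.

Section QuadraticSets.
Local Open Scope type_scope.

Record quadraticSet (X : Type) := QuadraticSet {
  qmap :> X * X -> X * X;
  qmap_bij : bijective qmap;
  qset_nonempty : inhabited X
}.

Variables (X : Type) (r : quadraticSet X).

(* r (x, y) = (sigma r x y, gamma r y x) *)
Definition sigma (x y : X) : X := (r (x, y)).1.
Definition gamma (y x : X) : X := (r (x, y)).2.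

Definition non_degenerate : Prop :=
  (forall x, bijective (sigma x)) /\ (forall x, bijective (gamma x)).

Definition square_free : Prop := forall x, r (x, x) = (x, x).

Definition r12 (p : X * X * X) : X * X * X := (r p.1, p.2).
Definition r23 (p : X * X * X) : X * X * X :=
  let q := r (p.1.2, p.2) in (p.1.1, q.1, q.2).

Definition braided : Prop :=
  forall p, r12 (r23 (r12 p)) = r23 (r12 (r23 p)).

End QuadraticSets.

Section Orbits.
Variables (X : finType) (r : quadraticSet X).

Definition qperm : {perm X * X} := perm (bij_inj (@qmap_bij _ r)).

(* [porbits s] is the set of orbits of the cyclic group <[s]>. *)
Definition r_orbits : {set {set X * X}} := porbits qperm.
End Orbits.

Definition freeMonoid (X : choiceType) : Type := seq X.
HB.instance Definition _ (X : choiceType) := Choice.copy (freeMonoid X) (seq X).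

Lemma cat_eq_nil (X : choiceType) (s t : freeMonoid X) :
  s ++ t = [::] -> s = [::] /\ t = [::].
Proof. by case: s => //= ->. Qed.

HB.instance Definition _ (X : choiceType) :=
  Choice_isMonomialDef.Build (freeMonoid X)
    (@catA X) (@cat0s X) (@cats0 X) (@cat_eq_nil X).

(* The free algebra K<X>, as the monoid algebra of the free monoid on X. *)
Definition freeAlgebra (K : fieldType) (X : choiceType) : Type :=
  {malg K[freeMonoid X]}.
HB.instance Definition _ (K : fieldType) (X : choiceType) :=
  GRing.Lalgebra.copy (freeAlgebra K X) {malg K[freeMonoid X]}.

Lemma freeAlgebra_scalerAr (K : fieldType) (X : choiceType) (c : K) (f g : freeAlgebra K X) :
  c *: (f * g) = f * (c *: g).
Proof.
apply/malgP => k; rewrite mcoeffZ mcoeffMl.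
rewrite (mcoeffMlw k (fsubset_refl _) (msuppZ_le c g)) big_distrr /=.
apply: eq_bigr => k1 _; rewrite big_distrr /=; apply: eq_bigr => k2 _.
by rewrite mcoeffZ mulrnAr mulrCA.
Qed.
HB.instance Definition _ (K : fieldType) (X : choiceType) :=
  GRing.Lalgebra_isAlgebra.Build K (freeAlgebra K X)
    (@freeAlgebra_scalerAr K X).

Definition free_gen (K : fieldType) (X : choiceType) (x : X) :
  freeAlgebra K X := << ([:: x] : freeMonoid X) >>.

Definition is_ideal (R : nzRingType) (J : R -> Prop) : Prop :=
  [/\ J 0, forall f g, J f -> J g -> J (f - g),
      forall a f, J f -> J (a * f) & forall a f, J f -> J (f * a)].

Definition ideal_gen (R : nzRingType) (S : R -> Prop) (f : R) : Prop :=
  forall J : R -> Prop, is_ideal J -> (forall g, S g -> J g) -> J f.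

Section StructureAlgebra.
Variables (K : fieldType) (X : choiceType) (r : quadraticSet X).
Local Notation F := (freeAlgebra K X).
Local Notation xi := (@free_gen K X).

Definition struct_rel (f : F) : Prop :=
  exists x y u v, r (x, y) = (u, v) /\ f = xi x * xi y - xi u * xi v.

Definition struct_ideal : {pred F} := fun f => `[< ideal_gen struct_rel f >].

Lemma struct_idealP : is_ideal struct_ideal.
Proof.
split=> [|f g /asboolP If /asboolP Ig|a f /asboolP If|a f /asboolP If];
  apply/asboolP => J HJ SJ; have [J0 JB JMl JMr] := HJ => //.
- by apply: JB; [apply: If|apply: Ig].
- by apply: JMl; apply: If.
- by apply: JMr; apply: If.
Qed.

Lemma struct_ideal_zmod : zmod_closed struct_ideal.
Proof. by case: struct_idealP. Qed.
HB.instance Definition _ :=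
  GRing.isZmodClosed.Build F struct_ideal struct_ideal_zmod.

Lemma struct_idealMl a f : f \in struct_ideal -> a * f \in struct_ideal.
Proof. by case: struct_idealP => _ _ H _; apply: H. Qed.

Lemma struct_idealMr a f : f \in struct_ideal -> f * a \in struct_ideal.
Proof. by case: struct_idealP => _ _ _ H; apply: H. Qed.

Lemma struct_idealN1 : 1 \notin struct_ideal.
Proof.
pose ev (f : F) : K := mcoeff ([::] : freeMonoid X) f.
have evM (f g : F) : ev (f * g) = ev f * ev g.
  exact: (rmorphM (mcoeff (mone : freeMonoid X))).
have ev_gen x : ev (xi x) = 0 by rewrite /ev /free_gen mcoeffU1.
have evI : is_ideal (fun f => ev f = 0).
  split=> [|f g f0 g0|a f f0|a f f0]; first exact: mcoeff0.
  - by rewrite /ev mcoeffB -!/(ev _) f0 g0 subrr.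
  - by rewrite evM f0 mulr0.
  - by rewrite evM f0 mul0r.
apply/negP => /asboolP /(_ _ evI) ev1.
suff /eqP : ev 1 = 0 by rewrite /ev mcoeff1 eqxx oner_eq0.
apply: ev1 => _ [x [y [u [v [_ ->]]]]].
by rewrite /ev mcoeffB -!/(ev _) !evM !ev_gen mul0r subrr.
Qed.

Definition structAlg : Type := @Quotient.quot F struct_ideal.
HB.instance Definition _ := GRing.Zmodule.on structAlg.
HB.instance Definition _ := @ZmodQuotient.on structAlg.

Local Notation A := structAlg.

Lemma struct_eqE (f g : F) : (f == g %[mod A]) = (f - g \in struct_ideal).
Proof. by rewrite -Quotient.idealrBE. Qed.

Definition sone : A := lift_cst A 1.
Definition smul := lift_op2 A *%R.
Definition sscale (c : K) := lift_op1 A ( *:%R c).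

Canonical pi_sone_morph := PiConst sone.

Lemma pi_smul : {morph \pi_A : f g / f * g >-> smul f g}.
Proof.
move=> f g; unlock smul; apply/eqP; rewrite struct_eqE.
rewrite -[f * g](addrNK (f * repr (\pi_A g))) -mulrBr -addrA -mulrBl.
apply: rpredD; first apply: struct_idealMl; last apply: struct_idealMr;
  by rewrite -struct_eqE reprK.
Qed.
Canonical pi_smul_morph := PiMorph2 pi_smul.

Lemma pi_sscale c : {morph \pi_A : f / c *: f >-> sscale c f}.
Proof.
move=> f; unlock sscale; apply/eqP; rewrite struct_eqE -scalerBr.
rewrite -[_ - _]mul1r scalerAl; apply: struct_idealMl.
by rewrite -struct_eqE reprK.
Qed.
Canonical pi_sscale_morph c := PiMorph1 (pi_sscale c).

Lemma smulA : associative smul.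
Proof. by move=> x y z; rewrite -[x]reprK -[y]reprK -[z]reprK !piE mulrA. Qed.
Lemma smul1r : left_id sone smul.
Proof. by move=> x; rewrite -[x]reprK !piE mul1r. Qed.
Lemma smulr1 : right_id sone smul.
Proof. by move=> x; rewrite -[x]reprK !piE mulr1. Qed.
Lemma smulDl : left_distributive smul +%R.
Proof.
by move=> x y z; rewrite -[x]reprK -[y]reprK -[z]reprK !piE mulrDl.
Qed.
Lemma smulDr : right_distributive smul +%R.
Proof.
by move=> x y z; rewrite -[x]reprK -[y]reprK -[z]reprK !piE mulrDr.
Qed.
Lemma sone_neq0 : sone != 0.
Proof. by rewrite !piE Quotient.equivE subr0 struct_idealN1. Qed.

HB.instance Definition _ := GRing.Zmodule_isNzRing.Build structAlg
  smulA smul1r smulr1 smulDl smulDr sone_neq0.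
HB.instance Definition _ := @isNzRingQuotient.Build F
  (Quotient.equiv struct_ideal) 0 -%R +%R 1%R *%R structAlg (lock _) pi_smul.

Lemma sscaleA a b (x : A) : sscale a (sscale b x) = sscale (a * b) x.
Proof. by rewrite -[x]reprK !piE scalerA. Qed.
Lemma sscale1 : left_id 1 sscale.
Proof. by move=> x; rewrite -[x]reprK !piE scale1r. Qed.
Lemma sscaleDr : right_distributive sscale +%R.
Proof. by move=> a x y; rewrite -[x]reprK -[y]reprK !piE scalerDr. Qed.
Lemma sscaleDl (x : A) : {morph sscale^~ x : a b / a + b}.
Proof. by move=> a b; rewrite -[x]reprK !piE scalerDl. Qed.

HB.instance Definition _ := GRing.Zmodule_isLmodule.Build K structAlg
  sscaleA sscale1 sscaleDr sscaleDl.

Lemma sscaleAl a (x y : A) : a *: (x * y) = a *: x * y.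
Proof.
rewrite /GRing.scale /GRing.mul /=.
by rewrite -[x]reprK -[y]reprK !piE -scalerAl.
Qed.
HB.instance Definition _ := GRing.Lmodule_isLalgebra.Build K structAlg sscaleAl.

Lemma sscaleAr a (x y : A) : a *: (x * y) = x * (a *: y).
Proof.
rewrite /GRing.scale /GRing.mul /=.
by rewrite -[x]reprK -[y]reprK !piE -scalerAr.
Qed.
HB.instance Definition _ := GRing.Lalgebra_isAlgebra.Build K structAlg sscaleAr.

(* The image of x in A(K, X, r). *)
Definition struct_gen (x : X) : A := \pi_A (xi x).

(* A_m: the linear combinations of products of m elements of X. *)
Definition graded_part (m : nat) (a : A) : Prop :=
  exists n (c : 'I_n -> K) (w : 'I_n -> m.-tuple X),
    a = \sum_(i < n) c i *: \prod_(x <- w i) struct_gen x.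

End StructureAlgebra.

Section Dimension.
Variables (K : fieldType) (V : lmodType K).

Definition lin_indep (d : nat) (e : 'I_d -> V) : Prop :=
  forall c : 'I_d -> K, \sum_(i < d) c i *: e i = 0 -> forall i, c i = 0.

Definition is_basis (W : V -> Prop) (d : nat) (e : 'I_d -> V) : Prop :=
  [/\ forall i, W (e i), lin_indep e &
      forall v, W v -> exists c : 'I_d -> K, v = \sum_(i < d) c i *: e i].

Definition has_dim (W : V -> Prop) (d : nat) : Prop :=
  exists e : 'I_d -> V, is_basis W e.
End Dimension.

(* Main.v *)
Require Import Defs.
From mathcomp Require Import all_boot all_fingroup all_algebra.
From mathcomp Require Import generic_quotient.
From mathcomp.classical Require Import boolp.
From mathcomp.finmap Require Import finmap.
From mathcomp.multinomials Require Import monalg.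

(** Send x to the pair act x = (sigma_x, gamma_x) of self-maps of X. The braid
    relation says that the pair of composites
      (sigma_x \o sigma_y, gamma_y \o gamma_x)
    depends only on the r-orbit of (x, y); by non-degeneracy, act x and this
    pair together determine act y ([action_prod_inv], [action_prod_cancel]).
    When act x = act y, square-freeness gives r (x, y) = (y, x) ([r_flip]), so
    X^2 splits r-invariantly into the pairs with act x = act y and the others.
    Put n = #|X| and let m be the number of values of act.

    On a fiber of act with f elements, r is the flip. The f diagonal pairs and
    the f - 1 pairs formed by a fixed element of the fiber with each other one
    lie in distinct orbits. Summed over the fibers, this gives 2n - m orbits
    ([card_fiber_pairs], [orbit_fiber_pairs_inj]).

    The pairs with act x <> act y are mapped, componentwise, onto the m (m - 1)
    off-diagonal pairs of values of act. In the image of one orbit a pair is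
    determined by its first component, so that such an image has at most m
    elements, and at least m - 1 orbits are needed ([card_mixed_orbits]). Both
    parts together give 2n - 1 orbits.

    As to dim A_2, the monomials xy and uv are equal in A when (x, y) and
    (u, v) are in the same orbit, so one monomial for each orbit spans A_2.
    For independence, adding up over an orbit O the coefficients of the words
    of length 2 in O gives a linear form on the free algebra. It vanishes on
    the defining ideal, because in each element of the ideal all words have
    length at least 2 and multiplication by a then acts in degree 2 through
    the constant term of a ([struct_ideal_coeff]). *)

Set Implicit Arguments.
Unset Strict Implicit.
Unset Printing Implicit Defensive.

(** * Orbits and the braid relation *)

Lemma porbit_invariant (T : finType) (U : Type) (s : {perm T}) (f : T -> U) :
  (forall p, f (s p) = f p) -> forall p q, q \in porbit s p -> f q = f p.
Proof.
move=> fs p q /porbitP[i ->]; elim: i => [|i IHi]; first by rewrite expg0 perm1.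
by rewrite expgSr permM fs.
Qed.

Lemma qpermE (X : finType) (r : quadraticSet X) p : qperm r p = r p.
Proof. by rewrite permE. Qed.

Lemma r_split (X : Type) (r : quadraticSet X) x y :
  r (x, y) = (sigma r x y, gamma r y x).
Proof. by rewrite /sigma /gamma; case: (r _). Qed.

Lemma sigma_braid (X : Type) (r : quadraticSet X) (r_br : braided r) x y z :
  sigma r (sigma r x y) (sigma r (gamma r y x) z) = sigma r x (sigma r y z).
Proof.
by have /(congr1 (fun p => p.1.1)) := r_br (x, y, z).
Qed.

Lemma gamma_braid (X : Type) (r : quadraticSet X) (r_br : braided r) x y z :
  gamma r z (gamma r y x) = gamma r (gamma r z y) (gamma r (sigma r y z) x).
Proof.
by have /(congr1 (fun p => p.2)) := r_br (x, y, z).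
Qed.

Definition braid_action (X : finType) (r : quadraticSet X) (x : X) :
    {ffun X -> X} * {ffun X -> X} :=
  ([ffun y => sigma r x y], [ffun y => gamma r x y]).

(** * Counting the orbits *)

Section OrbitCount.
Variables (X : finType) (r : quadraticSet X).
Hypotheses (r_nd : non_degenerate r) (r_sf : square_free r) (r_br : braided r).

Local Notation act := (braid_action r).
Local Notation orbit p := (porbit (qperm r) p).

Lemma eq_action x y :
  act x = act y -> sigma r x =1 sigma r y /\ gamma r x =1 gamma r y.
Proof.
case=> /ffunP Es /ffunP Eg.
by split=> z; [have := Es z | have := Eg z]; rewrite !ffunE.
Qed.

(** gamma composes in the order opposite to sigma, because the braid relation
    makes sigma an action and gamma an anti-action. *)
Definition action_prod (p : X * X) : {ffun X -> X} * {ffun X -> X} :=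
  ([ffun z => sigma r p.1 (sigma r p.2 z)],
   [ffun z => gamma r p.2 (gamma r p.1 z)]).

Lemma action_prod_inv p : action_prod (qperm r p) = action_prod p.
Proof.
rewrite qpermE; case: p => x y; rewrite r_split /action_prod /=.
congr pair; apply/ffunP => z; rewrite !ffunE /= ?sigma_braid //.
by rewrite -gamma_braid.
Qed.

(** sigma_x is cancelled on the left of sigma_x \o sigma_y by its injectivity,
    gamma_x on the right of gamma_y \o gamma_x by its surjectivity. *)
Lemma action_prod_cancel p q :
  action_prod p = action_prod q -> act p.1 = act q.1 -> act p.2 = act q.2.
Proof.
case: p q => [x y] [x' y'] /= [/ffunP Es /ffunP Eg] /eq_action[Ex gx].
have [sb gb] := r_nd; congr pair; apply/ffunP => z.
  by have := Es z; rewrite !ffunE /= -Ex => /(bij_inj (sb x)).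
have [h hK Kh] := gb x; have := Eg (h z).
by rewrite !ffunE /= -gx Kh.
Qed.

(** (sigma_x y, gamma_y x) = (sigma_y y, gamma_x x), and square-freeness says
    that sigma_y fixes y and gamma_x fixes x. *)
Lemma r_flip x y : act x = act y -> r (x, y) = (y, x).
Proof.
move=> /eq_action[Es Eg]; rewrite r_split Es -Eg.
by have:= r_sf x; have:= r_sf y; rewrite !r_split => -[-> _] [_ ->].
Qed.

Lemma same_action_inv p :
  (act (qperm r p).1 == act (qperm r p).2) = (act p.1 == act p.2).
Proof.
case: p => x y; apply/idP/idP => /= /eqP Exy; last first.
  by rewrite qpermE (r_flip Exy) /= Exy.
(* r (v, u) = (u, v) = r (x, y), and r is injective. *)
set p := (x, y) in Exy *; case Dq: (qperm r p) Exy => [u v] /= Euv.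
have: qperm r (v, u) = qperm r p by rewrite Dq qpermE r_flip.
by move/perm_inj; rewrite /p => -[<- <-]; rewrite Euv.
Qed.

Lemma same_action_orbit p q : q \in orbit p ->
  (act q.1 == act q.2) = (act p.1 == act p.2).
Proof.
exact: (porbit_invariant (f := fun p => act p.1 == act p.2) same_action_inv).
Qed.

Lemma orbit_flip x y q :
  act x = act y -> q \in orbit (x, y) -> q = (x, y) \/ q = (y, x).
Proof.
move=> Exy /porbitP[i ->].
elim: i => [|i IHi]; first by left; rewrite expg0 perm1.
rewrite expgSr permM.
case: IHi => ->; rewrite qpermE r_flip //; by [left | right].
Qed.

Definition fiber_rep x := odflt x [pick y | act y == act x].

Lemma fiber_repP x : act (fiber_rep x) = act x.
Proof. by rewrite /fiber_rep; case: pickP => //= y /eqP. Qed.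

Lemma eq_fiber_rep x y : act x = act y -> fiber_rep x = fiber_rep y.
Proof.
rewrite /fiber_rep => <-; case: pickP => //= /(_ x); by rewrite eqxx.
Qed.

(** Representatives of orbits within the fibers of act, 2 f - 1 of them for a
    fiber of f elements. *)
Definition fiber_pairs : {set X * X} :=
  [set (x, x) | x : X] :|: [set (fiber_rep x, x) | x : X & fiber_rep x != x].

Lemma card_reps : #|[set x | fiber_rep x == x]| = #|act @: X|.
Proof.
rewrite -(_ : act @: [set x | fiber_rep x == x] = act @: X).
  rewrite card_in_imset // => x y; rewrite !inE => /eqP {2}<- /eqP {2}<-.
  exact: eq_fiber_rep.
apply/eqP; rewrite eqEsubset imsetS ?subsetT //=; last by apply/subsetP.
apply/subsetP => _ /imsetP[x _ ->]; apply/imsetP; exists (fiber_rep x).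
  by rewrite inE; apply/eqP/eq_fiber_rep/fiber_repP.
by rewrite fiber_repP.
Qed.

Lemma card_fiber_pairs : #|fiber_pairs| + #|act @: X| = 2 * #|X|.
Proof.
rewrite cardsU (_ : _ :&: _ = set0) ?cards0 ?subn0; last first.
  apply/setP => p; rewrite !inE; apply/andP => -[/imsetP[x _ ->] /imsetP[y]].
  by rewrite inE => ny [Exy Eyx]; rewrite -Exy Eyx eqxx in ny.
rewrite (card_imset _ (f := fun x => (x, x))); last by move=> x y [].
rewrite (card_imset _ (f := fun x => (fiber_rep x, x))); last by move=> x y [].
rewrite -card_reps mul2n -addnn -addnA; congr addn.
rewrite -(cardsC [set x | fiber_rep x == x]) addnC; congr addn.
by apply: eq_card => x; rewrite !inE.
Qed.

Lemma fiber_pairs_same p : p \in fiber_pairs -> act p.1 = act p.2.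
Proof. by rewrite inE => /orP[] /imsetP[x _ ->] //=; rewrite fiber_repP. Qed.

(** Since r is the flip here, an orbit meets fiber_pairs twice only if (y, x)
    belongs to it together with (x, y); as fiber_rep is idempotent, this
    happens on the diagonal alone. *)
Lemma orbit_fiber_pairs_inj :
  {in fiber_pairs &, injective (fun p => orbit p)}.
Proof.
move=> [x y] q xyP qP Epq.
have /(orbit_flip (fiber_pairs_same xyP)) : q \in orbit (x, y).
  by rewrite Epq porbit_id.
case=> // Dq; rewrite {q}Dq in qP Epq *.
move: xyP qP; rewrite !inE.
case/orP=> /imsetP[a]; first by move=> _ [-> ->].
rewrite inE => na [-> ->].
case/orP=> /imsetP[b]; first by move=> _ [-> ->].
move=> _ [Eb Eba]; case/eqP: na.
by rewrite {2}Eb -Eba (eq_fiber_rep (fiber_repP a)).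
Qed.

Definition mixed_orbits : {set {set X * X}} :=
  [set orbit p | p : X * X & act p.1 != act p.2].

Definition act2 (p : X * X) := (act p.1, act p.2).

(** The first component is injective on the image of an orbit, as act x and
    the invariant product determine act y. *)
Lemma card_act2_orbit p : #|act2 @: orbit p| <= #|act @: X|.
Proof.
rewrite -(card_in_imset (f := fst) (D := mem (act2 @: orbit p))); last first.
  move=> _ _ /imsetP[q pq ->] /imsetP[q' pq' ->] /= E1.
  rewrite /act2 E1; congr pair; apply: action_prod_cancel E1.
  by rewrite !(porbit_invariant action_prod_inv (p := p)).
apply/subset_leq_card/subsetP => _ /imsetP[_ /imsetP[q _ ->] ->].
exact: imset_f.
Qed.

Lemma act2_mixed :
  setX (act @: X) (act @: X) :\: [set (a, a) | a in act @: X]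
    \subset cover [set act2 @: (O : {set _}) | O in mixed_orbits].
Proof.
apply/subsetP => -[a b]; rewrite !inE /=.
case/andP=> nab /andP[/imsetP[x _ Ea] /imsetP[y _ Eb]].
apply/bigcupP; exists (act2 @: orbit (x, y)); last first.
  by apply/imsetP; exists (x, y); rewrite ?porbit_id // /act2 -Ea -Eb.
apply/imset_f/imset_f; rewrite inE /= -Ea -Eb; apply: contra nab => /eqP <-.
by apply/imset_f; rewrite Ea imset_f.
Qed.

Lemma card_mixed_orbits : #|act @: X| <= 1 + #|mixed_orbits|.
Proof.
set m := #|_|.
have [->//|m_gt0] := posnP m.
(* It suffices that m * m - m <= #|mixed_orbits| * m. *)
rewrite -(leq_pmul2r m_gt0) mulnDl mul1n -leq_subLR.
apply: (@leq_trans
  #|setX (act @: X) (act @: X) :\: [set (a, a) | a in act @: X]|).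
  rewrite cardsD cardsX leq_sub2l //.
  rewrite -[m](card_imset _ (f := fun a => (a, a))); last by move=> a b [].
  by apply: subset_leq_card; apply: subsetIr.
apply: leq_trans (subset_leq_card act2_mixed) _.
apply: leq_trans (leq_card_cover _).1 _.
set C := [set _ | _ in _].
apply: (@leq_trans (\sum_(B in C) m)).
  apply: leq_sum => _ /imsetP[_ /imsetP[p _ ->] ->]; exact: card_act2_orbit.
by rewrite sum_nat_const leq_mul2r leq_imset_card orbT.
Qed.

Lemma fiber_mixed_disjoint :
  [disjoint [set orbit p | p in fiber_pairs] & mixed_orbits].
Proof.
apply/pred0P => O /=; apply/negbTE/negP.
case/andP=> /imsetP[p Fp ->] /imsetP[q]; rewrite inE => nq Epq.
have /same_action_orbit : p \in orbit q by rewrite -Epq porbit_id.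
by rewrite (fiber_pairs_same Fp) eqxx (negbTE nq).
Qed.

Lemma card_r_orbits_ge : 2 * #|X| - 1 <= #|r_orbits r|.
Proof.
rewrite leq_subLR -card_fiber_pairs addnC.
rewrite -(card_in_imset orbit_fiber_pairs_inj).
apply: leq_trans (leq_add card_mixed_orbits (leqnn _)) _.
rewrite -addnA leq_add2l addnC.
have := (leq_card_setU [set orbit p | p in fiber_pairs] mixed_orbits).2.
rewrite fiber_mixed_disjoint => /eqP <-.
apply/subset_leq_card; rewrite subUset; apply/andP; split.
  by apply/subsetP => _ /imsetP[p _ ->]; apply: imset_f.
by apply/subsetP => _ /imsetP[p _ ->]; apply: imset_f.
Qed.
End OrbitCount.

(** * The dimension of the degree 2 part *)

Section DegreeTwo.
Import GRing.Theory.
Local Open Scope ring_scope.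
Local Open Scope quotient_scope.
Variables (K : fieldType) (X : finType) (r : quadraticSet X).
Local Notation F := (freeAlgebra K X).
Local Notation A := (structAlg K r).
Local Notation M := (freeMonoid X).
Local Notation orbit p := (porbit (qperm r) p).

Implicit Types (a f : F) (w : M) (p q : X * X).

Definition no_low_words f := forall w : M, (size w < 2)%N -> mcoeff w f = 0.

(** A factorization of w as k ++ k2 with k nonempty leaves at most one letter
    to k2, where f has no coefficient. *)
Lemma mcoeffM_lowl a f w : no_low_words f -> (size w <= 2)%N ->
  mcoeff w (a * f) = mcoeff ([::] : M) a * mcoeff w f.
Proof.
move=> f0 w2.
rewrite (mcoeffMlw w (fsubsetUl _ [fset ([::] : M)])
                     (fsubsetUl _ [fset w]))%fset.
rewrite (big_fsetD1 ([::] : M)) /=; last by rewrite !inE eqxx orbT.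
rewrite [X in _ + X]big1_fset ?addr0 => [|k]; last first.
  rewrite !inE => /andP[kN _] _; apply: big1 => k2 _.
  case: eqP => //= Dw; rewrite f0 ?mulr0 ?mul0rn //.
  apply: leq_trans w2; rewrite -Dw size_cat.
  by case: k kN {Dw} => //= x k _; rewrite !addSn !ltnS leq_addl.
rewrite (big_fsetD1 w) /=; last by rewrite !inE eqxx orbT.
rewrite eqxx big1_fset ?addr0 // => k; rewrite !inE => /andP[kN _] _.
by rewrite (_ : (_ == _) = false) //; apply: negbTE.
Qed.

Lemma mcoeffM_lowr a f w : no_low_words f -> (size w <= 2)%N ->
  mcoeff w (f * a) = mcoeff w f * mcoeff ([::] : M) a.
Proof.
move=> f0 w2.
rewrite (mcoeffMrw w (fsubsetUl _ [fset w])
                     (fsubsetUl _ [fset ([::] : M)]))%fset.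
rewrite (big_fsetD1 ([::] : M)) /=; last by rewrite !inE eqxx orbT.
rewrite [X in _ + X]big1_fset ?addr0 => [|k]; last first.
  rewrite !inE => /andP[kN _] _; apply: big1 => k2 _.
  case: eqP => //= Dw; rewrite f0 ?mul0r ?mul0rn //.
  apply: leq_trans w2; rewrite -Dw size_cat.
  by case: k kN {Dw} => //= x k _; rewrite !addnS !ltnS leq_addr.
rewrite (big_fsetD1 w) /=; last by rewrite !inE eqxx orbT.
rewrite (_ : mmul w _ = w) ?eqxx; last exact: cats0.
rewrite big1_fset ?addr0 // => k; rewrite !inE => /andP[kN _] _.
rewrite (_ : mmul k _ = k); last exact: cats0.
by rewrite (negbTE kN).
Qed.

Definition orbit_coeff p f :=
  \sum_(q in orbit p) mcoeff ([:: q.1; q.2] : M) f.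

Lemma orbit_coeff_sum (I : finType) (c : I -> K) (f : I -> F) p :
  orbit_coeff p (\sum_i c i *: f i) = \sum_i c i * orbit_coeff p (f i).
Proof.
transitivity (\sum_(q in orbit p) \sum_i
                c i * mcoeff ([:: q.1; q.2] : M) (f i)).
  apply: eq_bigr => q _; rewrite raddf_sum; apply: eq_bigr => i _.
  exact: mcoeffZ.
by rewrite exchange_big; apply: eq_bigr => i _; rewrite mulr_sumr.
Qed.

Lemma free_genM x y :
  free_gen K x * free_gen K y = << ([:: x; y] : M) >> :> F.
Proof. by etransitivity; [apply: fgmulUU | rewrite mulr1]. Qed.

Lemma orbit_coeff_word p q :
  orbit_coeff p (free_gen K q.1 * free_gen K q.2) = (q \in orbit p)%:R.
Proof.
rewrite free_genM /orbit_coeff.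
under eq_bigr => q' _ do rewrite mcoeffU1.
have E (q' : X * X) : (([:: q.1; q.2] : M) == [:: q'.1; q'.2]) = (q' == q).
  by case: q q' => [a b] [c d] /=; apply/eqP/eqP => -[-> ->].
under eq_bigr do rewrite E.
rewrite -natr_sum; congr (_%:R).
have [qp|nqp] := boolP (q \in orbit p).
  by rewrite (bigD1 q) //= eqxx big1 // => i /andP[_ /negbTE->].
by rewrite big1 // => i ip; case: eqP ip nqp => // -> ->.
Qed.

(** The first conclusion makes the second one stable under multiplication:
    without words of length at most 1 in f, the degree 2 part of a * f is a
    multiple of that of f. *)
Lemma struct_ideal_coeff f : f \in @struct_ideal K X r ->
  no_low_words f /\ forall p, orbit_coeff p f = 0.
Proof.
move/asboolP/(_ (fun f => no_low_words f /\ forall p, orbit_coeff p f = 0)).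
apply=> [|_ [x [y [u [v [Ruv ->]]]]]].
  split=> [|f1 f2 [f1l f1o] [f2l f2o]|a f1 [f1l f1o]|a f1 [f1l f1o]].
  - split=> [w _|p]; first exact: mcoeff0.
    by rewrite /orbit_coeff big1 // => q _; rewrite mcoeff0.
  - split=> [w w2|p]; first by rewrite mcoeffB f1l // f2l // subr0.
    have:= f1o p; have:= f2o p; rewrite /orbit_coeff => e2 e1.
    by under eq_bigr do rewrite mcoeffB; rewrite sumrB e1 e2 subr0.
  - split=> [w w2|p]; first by rewrite mcoeffM_lowl // ?f1l ?mulr0 // ltnW.
    rewrite /orbit_coeff; under eq_bigr do rewrite mcoeffM_lowl //.
    by rewrite -mulr_sumr -/(orbit_coeff p f1) f1o mulr0.
  split=> [w w2|p]; first by rewrite mcoeffM_lowr // ?f1l ?mul0r // ltnW.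
  rewrite /orbit_coeff; under eq_bigr do rewrite mcoeffM_lowr //.
  by rewrite -mulr_suml -/(orbit_coeff p f1) f1o mul0r.
split=> [w w2|p].
  have nw (a b : X) : (([:: a; b] : M) == w) = false.
    by apply/negbTE/eqP => Dw; rewrite -Dw in w2.
  by rewrite !free_genM mcoeffB !mcoeffU1 !nw subrr.
rewrite /orbit_coeff; under eq_bigr do rewrite mcoeffB.
rewrite sumrB -!/(orbit_coeff p _).
rewrite (orbit_coeff_word p (x, y)) (orbit_coeff_word p (u, v)).
have -> : ((u, v) \in orbit p) = ((x, y) \in orbit p); last exact: subrr.
rewrite -Ruv -qpermE -!eq_porbit_mem.
by have := porbit_perm (qperm r) 1 (x, y); rewrite expg1 => ->.
Qed.

Definition word2 p : A := struct_gen K r p.1 * struct_gen K r p.2.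

Lemma word2E p : word2 p = \pi_A (free_gen K p.1 * free_gen K p.2).
Proof. by rewrite /word2 /struct_gen rmorphM. Qed.

Lemma word2_orbit p q : q \in orbit p -> word2 q = word2 p.
Proof.
apply: porbit_invariant => {}p; rewrite qpermE !word2E; apply/eqP.
rewrite eq_sym struct_eqE; apply/asboolP => J _; apply.
by exists p.1, p.2, (r p).1, (r p).2; rewrite -!surjective_pairing.
Qed.

(** The orbit sums of coefficients separate the monomials of distinct
    orbits, and they are well defined on A. *)
Lemma sum_word2_eq0 (I : finType) (c : I -> K) (e : I -> X * X) p :
  \sum_i c i *: word2 (e i) = 0 -> \sum_(i | e i \in orbit p) c i = 0.
Proof.
pose f : F := \sum_i c i *: (free_gen K (e i).1 * free_gen K (e i).2).
have -> : \sum_i c i *: word2 (e i) = \pi_A f.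
  rewrite /f rmorph_sum /=; apply: eq_bigr => i _.
  by rewrite word2E [RHS]pi_sscale.
move/eqP; rewrite -[0 in X in X -> _](rmorph0 (\pi_A : {rmorphism F -> A})) /=.
rewrite struct_eqE subr0 => /struct_ideal_coeff[_ /(_ p)].
rewrite orbit_coeff_sum.
move=> s0; rewrite -[RHS]s0 big_mkcond /=; apply: eq_bigr => i _.
by rewrite orbit_coeff_word; case: ifP => _; rewrite ?mulr1 ?mulr0.
Qed.

Lemma graded_part2_dim : has_dim (@graded_part K X r 2) #|r_orbits r|.
Proof.
have orbit_idx p : exists j : 'I_#|r_orbits r|, orbit p = enum_val j.
  have pO : orbit p \in r_orbits r by apply: imset_f.
  by exists (enum_rank_in pO (orbit p)); rewrite enum_rankK_in.
have /fin_all_exists[rep repE] (i : 'I_#|r_orbits r|) :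
    exists p, orbit p = enum_val i.
  by have /imsetP[p _ ->] := enum_valP i; exists p.
exists (fun i => word2 (rep i)); split=> [i|c /sum_word2_eq0 c0 j|v].
- exists 1%N, (fun=> 1), (fun=> [tuple (rep i).1; (rep i).2]).
  by rewrite big_ord1 scale1r big_cons big_seq1.
- rewrite -(c0 (rep j)) (big_pred1 j) // => i /=.
  by rewrite -eq_porbit_mem !repE (inj_eq enum_val_inj).
case=> n [c [w ->]].
have /fin_all_exists[idx idxE] (i : 'I_n) :=
  orbit_idx (tnth (w i) 0, tnth (w i) 1).
exists (fun j => \sum_(i | idx i == j) c i).
rewrite (partition_big idx predT) //=; apply: eq_bigr => j _.
rewrite scaler_suml; apply: eq_bigr => i /eqP Dj; congr (_ *: _).
rewrite big_tuple big_ord_recl big_ord1.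
rewrite (_ : lift _ _ = 1); last exact: val_inj.
rewrite -(word2_orbit (q := (tnth (w i) 0, tnth (w i) 1))) //.
by rewrite -eq_porbit_mem idxE repE Dj.
Qed.
End DegreeTwo.

(** * The bounds *)

Theorem theorem5p2 (X : finType) (r : quadraticSet X)
    (r_nd : non_degenerate r) (r_sf : square_free r) (r_br : braided r) :
  (2 * #|X| - 1 <= #|r_orbits r|)%N /\
  (forall K : fieldType,
     exists d : nat,
       has_dim (@graded_part K X r 2) d /\ (2 * #|X| - 1 <= d)%N).
Proof.
have ge_orbits := card_r_orbits_ge r_nd r_sf r_br.
split=> // K; exists #|r_orbits r|; split=> //; exact: graded_part2_dim.
Qed.
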